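(* Let $\mathbb F$ be a field and $k\ge 2$ an integer, and let $\mathcal D\subseteq\mathrm{Mat}(k+1,\mathbb F)$ be an $\mathbb F$-linear subspace of dimension $k+1$ all of whose nonzero elements have rank $k+1$ (a $[(k+1)\times(k+1),k+1,k+1]_{\mathbb F}$ MRD code). Then $\mathcal C_{\mathcal D}:=\pi(\phi_{1,k-1}(\mathcal D))\subseteq\mathrm{U}(2k-1,\mathbb F)$ is a $\{2k-1,k+1,k^2-1\}_{\mathbb F}$ maximum flag-rank distance (MFRD) code.
   Context: $\mathrm{U}(n,\mathbb F)$ is the space of $n\times n$ upper triangular matrices over $\mathbb F$. For $M\in\mathrm{U}(n,\mathbb F)$, $M_{[i]}$ is the submatrix with rows $1,\dots,i$ and columns $i,\dots,n$, and $\mathrm{w}_{\mathrm{fr}}(M)=\sum_{i=1}^n\operatorname{rk}(M_{[i]})$. An $\{n,t,\delta\}_{\mathbb F}$ code is an $\mathbb F$-linear subspace of $\mathrm{U}(n,\mathbb F)$ of dimension $t$ whose minimum flag-rank weight over nonzero elements is $\delta$. Let $g(\delta)=\delta-1+\lfloor\sqrt{\delta-1}\rfloor\cdot\lfloor(\sqrt{4(\delta-1)+1}-1)/2\rfloor$ and $f(n,\delta)=n(n+1)/2-g(\delta)$; a code is MFRD if it is an $\{n,f(n,\delta),\delta\}_{\mathbb F}$ code for some $\delta\ge 1$. The map $\pi:\mathrm{Mat}(n,\mathbb F)\to\mathrm{U}(n,\mathbb F)$ sets all entries below the main diagonal to $0$. For $\ell,i,j\ge1$ with $i+\ell-1\le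 n$, $j+\ell-1\le n$, $\phi_{i,j}:\mathrm{Mat}(\ell,\mathbb F)\to\mathrm{Mat}(n,\mathbb F)$ places $M$ in rows $i,\dots,i+\ell-1$ and columns $j,\dots,j+\ell-1$ and puts $0$ elsewhere (here $n=2k-1$, $\ell=k+1$). *)

(* Defs.v *)
From HB Require Import structures.
From mathcomp Require Import all_boot all_order all_algebra.
From mathcomp Require Import realalg.

Set Implicit Arguments.
Unset Strict Implicit.
Unset Printing Implicit Defensive.

Import Order.TTheory GRing.Theory Num.Theory.

Local Open Scope ring_scope.

(* [is_trig_mx] means lower triangular, hence the transpose. *)
Definition upper_trig (F : fieldType) (n : nat) (M : 'M[F]_n) : bool :=
  is_trig_mx M^T.

Lemma upper_trigP (F : fieldType) (n : nat) (M : 'M[F]_n) :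
  reflect (forall i j : 'I_n, (j < i)%N -> M i j = 0) (upper_trig M).
Proof.
apply: (iffP is_trig_mxP) => M0 i j ltij; first by have := M0 j i ltij; rewrite mxE.
by rewrite mxE M0.
Qed.

Lemma flag_col_subproof (n : nat) (i : 'I_n) (b : 'I_(n - i)) : (i + b < n)%N.
Proof. by rewrite -ltn_subRL. Qed.

Definition flag_col (n : nat) (i : 'I_n) (b : 'I_(n - i)) : 'I_n :=
  Ordinal (flag_col_subproof b).

(* With the 0-based index [i], this is M_[i+1]: the rows 0, ..., i and the
   columns i, ..., n-1 of M. *)
Definition flag_mx (F : fieldType) (n : nat) (M : 'M[F]_n) (i : 'I_n) :
    'M[F]_(i.+1, n - i) :=
  mxsub (widen_ord (ltn_ord i)) (@flag_col n i) M.

Definition flag_rank (F : fieldType) (n : nat) (M : 'M[F]_n) : nat :=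
  (\sum_(i < n) \rank (flag_mx M i))%N.

Definition is_code (F : fieldType) (n t delta : nat) (C : {vspace 'M[F]_n}) :
    Prop :=
  [/\ forall M, M \in C -> upper_trig M,
      \dim C = t,
      exists M, [/\ M \in C, M != 0 & flag_rank M = delta]
    & forall M, M \in C -> M != 0 -> (delta <= flag_rank M)%N].

(* Only square roots of integers occur, so they are taken in the real closed
   field of real algebraic numbers. *)
Definition g (delta : nat) : int :=
  let d : int := delta%:Z - 1 in
  d + Num.floor (Num.sqrt (d%:~R : realalg))
      * Num.floor ((Num.sqrt (4 * d%:~R + 1 : realalg) - 1) / 2).

Definition f (n delta : nat) : int := ((n * (n + 1)) %/ 2)%N%:Z - g delta.

Definition is_MFRD (F : fieldType) (n : nat) (C : {vspace 'M[F]_n}) : Prop :=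
  exists t delta : nat,
    [/\ (1 <= delta)%N, t%:Z = f n delta & is_code t delta C].

Definition pi_upper (F : fieldType) (n : nat) (M : 'M[F]_n) : 'M[F]_n :=
  \matrix_(r, c) if (r <= c)%N then M r c else 0.

(* [i] and [j] are 1-based positions, [r], [c], [a], [b] are 0-based. At most
   one pair (a, b) contributes to the entry (r, c), see [phiE] and [phi_out]. *)
Definition phi (F : fieldType) (l n i j : nat) (M : 'M[F]_l) : 'M[F]_n :=
  \matrix_(r, c) \sum_(a < l | (i + a)%N == r.+1)
                   \sum_(b < l | (j + b)%N == c.+1) M a b.

Lemma phiE (F : fieldType) (l n i j : nat) (M : 'M[F]_l)
    (r c : 'I_n) (a b : 'I_l) :
  r.+1 = (i + a)%N -> c.+1 = (j + b)%N -> phi n i j M r c = M a b.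
Proof.
move=> ra cb; rewrite mxE (big_pred1 a) => [|a' /=]; last first.
  by rewrite ra eqn_add2l.
by rewrite (big_pred1 b) // => b' /=; rewrite cb eqn_add2l.
Qed.

Lemma phi_out (F : fieldType) (l n i j : nat) (M : 'M[F]_l) (r c : 'I_n) :
  ~~ ((i <= r.+1 < i + l) && (j <= c.+1 < j + l))%N -> phi n i j M r c = 0.
Proof.
move=> out; rewrite mxE big1 // => a /eqP ra; rewrite big1 // => b /eqP cb.
by move: out; rewrite -ra -cb !leq_addr !ltn_add2l !ltn_ord.
Qed.

Lemma pi_upper_is_linear (F : fieldType) (n : nat) : linear (@pi_upper F n).
Proof.
by move=> x A B; apply/matrixP=> r c; rewrite !mxE; case: ifP => // _; rewrite mulr0 addr0.
Qed.

HB.instance Definition _ (F : fieldType) (n : nat) :=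
  GRing.isLinear.Build F 'M[F]_n 'M[F]_n *:%R (@pi_upper F n)
    (@pi_upper_is_linear F n).

Lemma phi_is_linear (F : fieldType) (l n i j : nat) : linear (@phi F l n i j).
Proof.
move=> x A B; apply/matrixP=> r c; rewrite !mxE mulr_sumr -big_split /=.
apply: eq_bigr => a _; rewrite mulr_sumr -big_split /=.
by apply: eq_bigr => b _; rewrite !mxE.
Qed.

HB.instance Definition _ (F : fieldType) (l n i j : nat) :=
  GRing.isLinear.Build F 'M[F]_l 'M[F]_n *:%R (@phi F l n i j)
    (@phi_is_linear F l n i j).

Definition code_of (F : fieldType) (k : nat) (D : {vspace 'M[F]_(k + 1)}) :
    {vspace 'M[F]_(2 * k - 1)} :=
  (linfun (@pi_upper F (2 * k - 1)) @:
     (linfun (@phi F (k + 1) (2 * k - 1) 1 (k - 1)) @: D))%VS.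

Lemma code_ofP (F : fieldType) (k : nat) (D : {vspace 'M[F]_(k + 1)}) N :
  reflect (exists2 M, M \in D & N = pi_upper (phi (2 * k - 1) 1 (k - 1) M))
          (N \in code_of D).
Proof.
apply: (iffP memv_imgP) => [[_ /memv_imgP[M MD ->] ->]|[M MD ->]].
  by exists M => //; rewrite !lfunE.
by exists (phi (2 * k - 1) 1 (k - 1) M); rewrite ?lfunE // -lfunE memv_img.
Qed.

(* Main.v *)
(** An a x b submatrix of an invertible matrix of order l has rank at least
    a + b - l.  The matrix [M_[i]] of a codeword contains the last min(n-i+1, k+1)
    columns of the first min(i, k+1) rows of an invertible matrix of order k + 1,
    so the ranks are at least 1, ..., k-1, k-1, k-1, ..., 1, which add up to
    k^2 - 1.  Since taking the first row is injective on D, dimension count gives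
    a matrix of D with first row (1, 0, ..., 0); it makes the central k x k block
    singular, and the bound is attained. *)

Require Import Defs.
From mathcomp Require Import all_boot all_order all_algebra.
From mathcomp Require Import realalg zify lra.

Import Order.TTheory GRing.Theory Num.Theory.

Local Open Scope ring_scope.

Lemma rank_rowsub1 (F : fieldType) (m n : nat) (h : 'I_m -> 'I_n) :
  injective h -> \rank (rowsub h (1%:M : 'M[F]_n)) = m.
Proof.
move=> h_inj; apply/eqP; rewrite -/(row_free _); apply/row_freeP.
exists (rowsub h 1%:M)^T; rewrite mul_rowsub_mx mul1mx.
by apply/matrixP=> i j; rewrite !mxE (inj_eq h_inj) eq_sym.
Qed.

Lemma mxsubE1 (F : fieldType) (m n p q : nat) (h : 'I_p -> 'I_m)
    (h' : 'I_q -> 'I_n) (A : 'M[F]_(m, n)) :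
  mxsub h h' A = rowsub h 1%:M *m A *m (rowsub h' 1%:M)^T.
Proof. by rewrite -rowsubE trmx_mxsub trmx1 mulmx_colsub mulmx1 mxsubcr. Qed.

Lemma rank_mxsub (F : fieldType) (m n p q : nat) (h : 'I_p -> 'I_m)
    (h' : 'I_q -> 'I_n) (A : 'M[F]_(m, n)) :
  (\rank (mxsub h h' A) <= \rank A)%N.
Proof.
by rewrite mxsubE1 (leq_trans (mxrankM_maxl _ _)) // mxrankM_maxr.
Qed.

(** Sylvester's inequality for the product of the [p] selected rows of [A], still of rank [p] since
    [A] is invertible, with the column selection, of rank [q]. *)
Lemma rank_mxsub_full (F : fieldType) (n p q : nat) (h : 'I_p -> 'I_n)
    (h' : 'I_q -> 'I_n) (A : 'M[F]_n) :
    injective h -> injective h' -> \rank A = n ->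
  (p + q - n <= \rank (mxsub h h' A))%N.
Proof.
move=> h_inj h'_inj rkA; rewrite mxsubE1.
have freeA : row_free A by rewrite /row_free rkA.
have := mxrank_mul_min (rowsub h 1%:M *m A) (rowsub h' 1%:M)^T.
by rewrite mxrankMfree // mxrank_tr !rank_rowsub1.
Qed.

Lemma rank_row0 (F : fieldType) (m n : nat) (A : 'M[F]_(m, n)) (i : 'I_m) :
  row i A = 0 -> (\rank A < m)%N.
Proof.
move=> Ai0; rewrite ltn_neqAle rank_leq_row andbT; apply/negP=> freeA.
have := mulmx_free_eq0 (delta_mx 0 i : 'rV_m) freeA.
rewrite -rowE Ai0 eqxx => /esym/eqP/matrixP/(_ 0 i)/eqP.
by rewrite !mxE !eqxx oner_eq0.
Qed.

Lemma flag_mx_pi_upper (F : fieldType) (n : nat) (M : 'M[F]_n) (i : 'I_n) :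
  flag_mx (pi_upper M) i = flag_mx M i.
Proof.
apply/matrixP=> r c; rewrite !mxE /= ifT //.
by rewrite (leq_trans _ (leq_addr _ _)) // -ltnS.
Qed.

(* Here [k = m + 1] and [n = 2 k - 1]; the correction at [i = m] accounts for the
   central [k x k] block, whose rank is only bounded below by [k - 1]. *)
Lemma sum_flag_profile (m : nat) :
  (\sum_(i < m.*2.+1) (minn i.+1 (m.*2.+1 - i) - (i == m :> nat)) =
   m * m.+2)%N.
Proof.
elim: m => [|m IHm]; first by rewrite big_ord1.
(* The two end terms are 1, and each of the [m.*2.+1] inner terms exceeds by one its counterpart in
   the profile for [m]. *)
rewrite doubleS big_ord_recl big_ord_recr /=.
under eq_bigr => i _.
  rewrite (_ : (_ - _)%N =
    (minn i.+1 (m.*2.+1 - i) - (i == m :> nat)).+1); last first.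
    by have := ltn_ord i; rewrite /bump /=; lia.
  rewrite -addn1; over.
rewrite big_split /= IHm sum1_card card_ord /bump /=; lia.
Qed.

Lemma flag_rank_code (F : fieldType) (k : nat) (M : 'M[F]_(k + 1)) :
    (2 <= k)%N -> \rank M = (k + 1)%N ->
  (k ^ 2 - 1 <= flag_rank (pi_upper (phi (2 * k - 1) 1 (k - 1) M)))%N.
Proof.
move=> k2 rkM.
have [m k_m] : exists m, k = m.+1 by exists k.-1; lia.
have n_m : (2 * k - 1 = m.*2.+1)%N by lia.
have -> : (k ^ 2 - 1 = m * m.+2)%N by rewrite k_m; lia.
rewrite -sum_flag_profile -n_m /flag_rank; apply: leq_sum => i _.
rewrite flag_mx_pi_upper; set A := flag_mx _ _.
have lt_in := ltn_ord i.
(* [M] occupies the first [k + 1] rows and the last [k + 1] columns, so [A] contains the first [a]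
   rows and last [b] columns of [M]; [h], [h'] locate this block in [M], and [u], [u'] in [A]. *)
pose a := minn i.+1 (k + 1); pose b := minn (2 * k - 1 - i) (k + 1).
have hP (r : 'I_a) : (r < k + 1)%N by have := ltn_ord r; lia.
have h'P (c : 'I_b) : (k + 1 - b + c < k + 1)%N by have := ltn_ord c; lia.
have uP (r : 'I_a) : (r < i.+1)%N by have := ltn_ord r; lia.
have u'P (c : 'I_b) : (2 * k - 1 - i - b + c < 2 * k - 1 - i)%N.
  by have := ltn_ord c; lia.
pose h r := Ordinal (hP r); pose h' c := Ordinal (h'P c).
pose u r := Ordinal (uP r); pose u' c := Ordinal (u'P c).
have h_inj : injective h by move=> r s [] /val_inj.
have h'_inj : injective h' by move=> r s [] /addnI/val_inj.
have E : mxsub u u' A = mxsub h h' M.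
  apply/matrixP=> r c; rewrite [LHS]mxE [LHS]mxE [RHS]mxE.
  apply: phiE => /=; first by rewrite add1n.
  by have := ltn_ord c; lia.
apply: leq_trans (rank_mxsub _ _ _ _ _ u u' A); rewrite E.
(* Off the middle, [a] or [b] equals [k + 1] and the bound is the other one; at [i = m] both equal
   [k], which leaves [k - 1]. *)
apply: leq_trans (rank_mxsub_full _ _ _ _ _ _ _ h_inj h'_inj rkM).
by rewrite /a /b; case: eqP; lia.
Qed.

Lemma flag_rank_code_min (F : fieldType) (k : nat) (M : 'M[F]_(k + 1))
    (r0 : 'I_(k + 1)) :
    (2 <= k)%N -> r0 = 0%N :> nat ->
    (forall c : 'I_(k + 1), (0 < c)%N -> M r0 c = 0) ->
  (flag_rank (pi_upper (phi (2 * k - 1) 1 (k - 1) M)) <= k ^ 2 - 1)%N.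
Proof.
move=> k2 r00 M0.
have [m k_m] : exists m, k = m.+1 by exists k.-1; lia.
have n_m : (2 * k - 1 = m.*2.+1)%N by lia.
have -> : (k ^ 2 - 1 = m * m.+2)%N by rewrite k_m; lia.
rewrite -sum_flag_profile -n_m /flag_rank; apply: leq_sum => i _.
rewrite flag_mx_pi_upper; set A := flag_mx _ _.
have rk_col : (\rank A <= 2 * k - 1 - i)%N by apply: rank_leq_col.
have [i_m | _] := eqVneq (i : nat) m; last by rewrite subn0 leq_min rank_leq_row.
have: (\rank A < i.+1)%N.
  apply: (@rank_row0 _ _ _ _ ord0); apply/rowP=> c; rewrite 2!mxE [RHS]mxE.
  have lt_c := ltn_ord c.
  (* The central block starts one column to the right of [M], so it misses column 0, the only place
     where row [r0] may be nonzero. *)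
  have lt_c1 : (c.+1 < k + 1)%N by lia.
  rewrite (@phiE _ _ _ _ _ M _ _ r0 (Ordinal lt_c1)) ?M0 //= ?r00 //; lia.
by lia.
Qed.

(** A matrix of [D] with a zero row is singular, hence zero; so [row i] is injective on [D], and
    onto because the dimensions agree. *)
Lemma full_rank_space_row (F : fieldType) (n : nat) (D : {vspace 'M[F]_n})
    (i : 'I_n) (v : 'rV[F]_n) :
    \dim D = n -> (forall M, M \in D -> M != 0 -> \rank M = n) ->
  exists2 M, M \in D & row i M = v.
Proof.
move=> dimD rkD; pose h := linfun (row i : 'M[F]_n -> 'rV[F]_n).
have ker0 : (D :&: lker h = 0)%VS.
  apply/eqP; rewrite -subv0; apply/subvP=> M /memv_capP[MD].
  rewrite memv_ker lfunE memv0 /= => /eqP /rank_row0 rkM.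
  by apply: contraTT rkM => /(rkD _ MD) ->; rewrite ltnn.
have full : (h @: D)%VS = fullv.
  apply/eqP; rewrite eqEdim subvf limg_dim_eq // dimD dimvf /dim /=.
  by rewrite mul1n.
have /memv_imgP[M MD ->] : v \in (h @: D)%VS by rewrite full memvf.
by exists M; rewrite // lfunE.
Qed.

Lemma sqrt_itv (R : rcfType) (a b x : R) :
  0 <= a -> 0 <= b -> a ^+ 2 <= x < b ^+ 2 -> a <= Num.sqrt x < b.
Proof.
move=> a_ge0 b_ge0 /andP[ax xb]; have x_ge0 := le_trans (sqr_ge0 a) ax.
rewrite -(@ler_pXn2r _ 2) ?nnegrE ?sqrtr_ge0 // sqr_sqrtr // ax /=.
by rewrite -(@ltr_pXn2r _ 2) ?nnegrE ?sqrtr_ge0 // sqr_sqrtr.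
Qed.

(** Here [d = k^2 - 2], and both floors are [k - 1]: for [k >= 2], [(k-1)^2 <= k^2 - 2 < k^2] and
    [(2k-1)^2 <= 4k^2 - 7 < (2k)^2]. *)
Lemma g_code (k : nat) :
  (2 <= k)%N -> g (k ^ 2 - 1) = k%:Z ^+ 2 - 2 + (k%:Z - 1) ^+ 2.
Proof.
move=> k2; rewrite /g; set d : int := _ - 1.
have d_k : d = k%:Z ^+ 2 - 2 by rewrite /d; nia.
pose K : realalg := k%:~R.
have K2 : 2 <= K by rewrite -[2]/(2%:~R) ler_int.
have dK : d%:~R = K ^+ 2 - 2 :> realalg by rewrite d_k rmorphB rmorphXn.
have floor1 : Num.floor (Num.sqrt (d%:~R : realalg)) = k%:Z - 1.
  apply: floor_def; rewrite subrK rmorphB /= -/K dK.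
  by apply: sqrt_itv; [lra | lra | apply/andP; split; nra].
have floor2 :
    Num.floor ((Num.sqrt (4 * d%:~R + 1 : realalg) - 1) / 2) = k%:Z - 1.
  apply: floor_def; rewrite subrK rmorphB /= -/K dK.
  have : 2 * K - 1 <= Num.sqrt (4 * (K ^+ 2 - 2) + 1) < 2 * K.
    by apply: sqrt_itv; [lra | lra | apply/andP; split; nra].
  by move=> /andP[le_sqrt lt_sqrt]; apply/andP; split; lra.
by rewrite floor1 floor2 d_k expr2.
Qed.

(** The two terms of [f] are [2k^2 - k] and [2k^2 - 2k - 1]. *)
Lemma f_code (k : nat) : (2 <= k)%N -> (k + 1)%:Z = f (2 * k - 1) (k ^ 2 - 1).
Proof.
move=> k2; rewrite /f g_code //.
have -> : ((2 * k - 1) * (2 * k - 1 + 1) %/ 2 = (2 * k - 1) * k)%N.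
  by rewrite subnK ?(mulnCA _ 2) ?mulKn //; lia.
by nia.
Qed.

Theorem theorem4p11 (F : fieldType) (k : nat) (hk : (2 <= k)%N)
    (D : {vspace 'M[F]_(k + 1)})
    (hdim : \dim D = (k + 1)%N)
    (hrank : forall M : 'M[F]_(k + 1),
        M \in D -> M != 0 -> \rank M = (k + 1)%N) :
  @is_code F (2 * k - 1) (k + 1) (k ^ 2 - 1) (code_of D) /\
  is_MFRD (code_of D).
Proof.
suff code : @is_code F (2 * k - 1) (k + 1) (k ^ 2 - 1) (code_of D).
  split=> //; exists (k + 1)%N, (k ^ 2 - 1)%N; split=> //; last exact: f_code.
  by nia.
pose enc (M : 'M[F]_(k + 1)) := pi_upper (phi (2 * k - 1) 1 (k - 1) M).
have enc0 : enc 0 = 0 by rewrite /enc !linear0.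
have flag_rank0 : flag_rank (0 : 'M[F]_(2 * k - 1)) = 0%N.
  by apply: big1 => i _; rewrite /flag_mx [mxsub _ _ _](_ : _ = 0) ?mxrank0 //;
    apply/matrixP=> r c; rewrite !mxE.
(* A nonzero codeword has flag rank at least [k^2 - 1 > 0], so [enc] is injective on [D] and
   preserves its dimension. *)
have enc_neq0 M : M \in D -> M != 0 -> enc M != 0.
  move=> MD /(hrank _ MD) rkM; apply/eqP=> enc_M.
  by have := flag_rank_code _ _ _ hk rkM; rewrite -/(enc M) enc_M flag_rank0; nia.
have lt0 : (0 < k + 1)%N by rewrite addn1.
pose r0 := Ordinal lt0.
split.
- move=> _ /code_ofP[M _ ->]; apply/upper_trigP=> i j lt_ji.
  by rewrite mxE leqNgt lt_ji.
- rewrite /code_of -limg_comp limg_dim_eq //.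
  apply/eqP; rewrite -subv0; apply/subvP=> M /memv_capP[MD].
  rewrite memv_ker comp_lfunE !lfunE memv0 /=.
  by apply: contraTT => /(enc_neq0 _ MD).
- have [M MD rowM] := full_rank_space_row _ _ _ r0 (delta_mx 0 r0) hdim hrank.
  have M_neq0 : M != 0.
    apply/eqP=> M0; move/rowP/(_ r0)/eqP: rowM.
    by rewrite M0 !mxE !eqxx eq_sym oner_eq0.
  exists (enc M); split; [by apply/code_ofP; exists M | exact: enc_neq0 |].
  apply/eqP; rewrite eqn_leq flag_rank_code ?hrank // andbT.
  apply: (flag_rank_code_min _ _ _ r0) => // c c_gt0.
  move/rowP/(_ c): rowM; rewrite !mxE eqxx => ->.
  by case: eqVneq c_gt0 => // ->.
- move=> _ /code_ofP[M MD ->] encM; apply: flag_rank_code => //.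
  by apply: hrank => //; apply: contraNneq encM => ->; rewrite -/(enc 0) enc0.
Qed.
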